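(* Let $G(x,t,z)$ and $F(x,t,z)$ be $m\times m$ matrix functions such that $G$, $F$ and the derivatives $G_t$ and $F_x$ exist on the semi-strip $\mathcal{D}=\{(x,t):\,0\le x<\infty,\ 0\le t<a\}$. Let $G$, $G_t$ and $F$ be continuous with respect to $x$ and $t$ on $\mathcal{D}$, and let the zero curvature equation $$G_t(x,t,z)-F_x(x,t,z)+[G(x,t,z),F(x,t,z)]=0$$ hold on $\mathcal{D}$. Let $W$ and $R$ be the normalized fundamental solutions defined by $$\frac{d}{dx}W(x,t,z)=G(x,t,z)W(x,t,z),\quad W(0,t,z)=I_m,$$ $$\frac{d}{dt}R(x,t,z)=F(x,t,z)R(x,t,z),\quad R(x,0,z)=I_m.$$ Then the equality $$W(x,t,z)R(t,z)=R(x,t,z)W(x,0,z),\qquad R(t,z):=R(0,t,z),$$ holds for all $(x,t)\in\mathcal{D}$.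
   Context: Matrix functions are complex-valued; $I_m$ is the $m\times m$ identity matrix; $[G,F]:=GF-FG$; subscripts $x$, $t$ denote partial derivatives (one-sided at the boundary points of $\mathcal{D}$); $a>0$. The variable $z$ is a complex spectral parameter which plays no role in the hypotheses or conclusion: it may be regarded as fixed. *)

(* Defs.v *)
From HB Require Import structures.
From mathcomp Require Import all_boot all_order all_algebra.
From mathcomp Require Import complex.
From mathcomp Require Import all_classical all_reals all_analysis.

Set Implicit Arguments.
Unset Strict Implicit.
Unset Printing Implicit Defensive.

Import Order.TTheory GRing.Theory Num.Theory.
Import numFieldNormedType.Exports.

Local Open Scope classical_set_scope.
Local Open Scope ring_scope.
Local Open Scope complex_scope.

(* The modulus topology on R[i]; MathComp-Analysis only puts it on the alias
   R[i]^o. With it, 'M[R[i]]_m is a normed space over R[i] (entrywise sup norm). *)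
HB.instance Definition _ (R : realType) := NormedModule.copy R[i] R[i]^o.

(* The derivative of f at x, relative to A, is l: the increments h are nonzero
   and keep x + h in A, so it is one-sided where A is an interval and x an
   endpoint belonging to it; values of f outside A are never used when A x. *)
Definition is_derive_in (R : realType) (m : nat) (A : set R)
    (f : R -> 'M[R[i]]_m) (x : R) (l : 'M[R[i]]_m) : Prop :=
  (h%:C)^-1 *: (f (x + h) - f x)
    @[h --> within [set h | A (x + h)] (0 : R)^'] --> l.

(* Y' = B Y on A and Y(0) = I_m *)
Definition normalized_solution (R : realType) (m : nat) (A : set R)
    (B Y : R -> 'M[R[i]]_m) : Prop :=
  (forall s, A s -> is_derive_in A Y s (B s *m Y s)) /\ Y 0 = 1%:M.

Definition semistrip (R : realType) (a : R) : set (R * R) :=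
  `[0, +oo[ `*` `[0, a[.

(* Main.v *)
Require Import Defs.
From HB Require Import structures.
From mathcomp Require Import all_boot all_order all_algebra.
From mathcomp Require Import complex.
From mathcomp Require Import all_classical all_reals all_analysis.
From mathcomp Require Import ring lra.

Set Implicit Arguments.
Unset Strict Implicit.
Unset Printing Implicit Defensive.

Import Order.TTheory GRing.Theory Num.Theory.
Import numFieldNormedType.Exports.

Local Open Scope classical_set_scope.
Local Open Scope ring_scope.
Local Open Scope complex_scope.

(** Along a line t = const, the function V = F W - W F(0, t) satisfies, by the
    zero curvature equation,
      V_x = F_x W + F G W - G W F(0, t) = G V + G_t W,   V(0) = 0.
    This is precisely the equation obtained by differentiating W_x = G W
    formally in t, so V should be W_t.  To prove it, put
    D = W(., t + h) - W(., t) - h V.  Then D(0) = 0 and D solves the linear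
    equation D_x = G(., t + h) D + B, where B is o(h) uniformly on [0, x]
    because G and G_t are continuous and [0, x] is compact; Gronwall's
    inequality makes D = o(h).  Knowing V beforehand is what lets
    differentiability in the parameter come from Gronwall alone, with neither
    variation of constants nor an existence theorem.

    With W_t = F W - W F(0, t) at hand
    ([fundamental_solution_derive_t]), both W(x, t) R(0, t) and
    R(x, t) W(x, 0) solve Y_t = F(x, t) Y, and both equal W(x, 0) at t = 0.
    Gronwall's inequality ([matrix_gronwall]) makes their difference vanish.

    The analytic input is real: a complex matrix is split into the real and
    imaginary parts of its entries, to which the mean value theorem and the
    monotonicity criterion for real functions apply. *)

(** * Limits and norms of complex matrices *)

Section matrix_limits.
Context (R : realType) (T : Type) (E : set_system T) {FE : Filter E}.

Lemma cvg_mx_entries (m n : nat) (f : T -> 'M[R[i]]_(m, n))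
    (l : 'M[R[i]]_(m, n)) :
  (forall i j, f s i j @[s --> E] --> l i j) -> f s @[s --> E] --> l.
Proof.
move=> fl; apply/cvg_mx_entourageP => A entA.
have : \forall s \near E, forall ij : 'I_m * 'I_n,
    A (l ij.1 ij.2, f s ij.1 ij.2).
  apply: filter_forall => -[i j].
  by move/cvg_app_entourageP: (fl i j); apply.
by rewrite near_simpl /=; apply: filterS => s h i j; apply/mem_set/(h (i, j)).
Qed.

Lemma cvg_entry (m n : nat) (f : T -> 'M[R[i]]_(m, n))
    (l : 'M[R[i]]_(m, n)) i j :
  f s @[s --> E] --> l -> f s i j @[s --> E] --> l i j.
Proof.
move=> fl.
apply: (@cvg_comp _ _ _ f (fun M : 'M[R[i]]_(m, n) => M i j) _ _ _ fl).
exact: (@coord_continuous _ m n i j l).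
Qed.

Lemma cvg_mulmx (m n p : nat) (f : T -> 'M[R[i]]_(m, n))
    (g : T -> 'M[R[i]]_(n, p))
    (k : 'M[R[i]]_(m, n)) (l : 'M[R[i]]_(n, p)) :
  f s @[s --> E] --> k -> g s @[s --> E] --> l ->
  f s *m g s @[s --> E] --> k *m l.
Proof.
move=> fk gl; apply: cvg_mx_entries => i j.
rewrite mxE; under eq_fun do rewrite mxE.
apply: cvg_big => [|q _]; first exact: add_continuous.
by apply: cvgM; exact: cvg_entry.
Qed.

End matrix_limits.

Lemma continuous_real_complex (R : realType) :
  continuous (fun x : R => x%:C : R[i]).
Proof.
move=> x; apply/cvgrPdist_le => e e0.
have [r re] : exists r : R, e = r%:C by apply/complex_realP; exact: gtr0_real.
rewrite re ltcR in e0 *.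
near=> y; rewrite -rmorphB /= normc_def /= expr0n addr0 sqrtr_sqr lecR.
by near: y; apply: cvgr_dist_le e0.
Unshelve. all: by end_near. Qed.

Section matrix_norm.
Context (R : realType).

Lemma entry_le_mx_norm (m n : nat) (A : 'M[R[i]]_(m, n)) i j : `|A i j| <= `|A|.
Proof.
have -> : `|A| = mx_norm A by [].
rewrite mx_normE -[leLHS]nngE num_le.
by apply/bigmax_geP; right; exists (i, j).
Qed.

Lemma mx_norm_le_entries (m n : nat) (A : 'M[R[i]]_(m, n)) (e : R) : 0 <= e ->
  (forall i j, `|A i j| <= e%:C) -> `|A| <= e%:C.
Proof.
move=> e0 Ae; have e0C : 0 <= e%:C by rewrite ler0c.
have -> : `|A| = mx_norm A by [].
rewrite mx_normE -[e%:C]/((NngNum e0C)%:num) num_le.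
by apply/bigmax_leP; split => // -[i j] _; rewrite -num_le /=.
Qed.

End matrix_norm.

Lemma normc_real (R : realType) (r : R) : `|r%:C| = `|r|%:C.
Proof. by rewrite normc_def /= expr0n addr0 sqrtr_sqr. Qed.

(** * Calculus of the relative derivative *)

Section relative_derivative.
Context (R : realType) (m : nat).
Implicit Types (A B : set R) (f g : R -> 'M[R[i]]_m).
Implicit Types (x : R) (k l : 'M[R[i]]_m).

Lemma is_derive_in_subset A B f x l :
  A `<=` B -> is_derive_in B f x l -> is_derive_in A f x l.
Proof.
move=> AB; rewrite /is_derive_in => fl; apply: (cvg_trans _ fl); apply: cvg_app.
by apply: within_subset => h; exact: AB.
Qed.

(** The product rule evaluates one factor at the displaced point x + h, so it
    needs continuity along the very filter of increments that defines the
    derivative. *)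
Lemma is_derive_in_cvg A f x l : is_derive_in A f x l ->
  f (x + h) @[h --> within [set h | A (x + h)] (0 : R)^'] --> f x.
Proof.
move=> fl; set E := within _ _.
have h0 : h%:C @[h --> E] --> (0%:C : R[i]).
  by do 2 apply: cvg_within_filter; exact: continuous_real_complex.
have fx : h%:C *: (h%:C^-1 *: (f (x + h) - f x)) + f x @[h --> E] --> f x.
  have e : 0%:C *: l + f x = f x by rewrite scale0r add0r.
  rewrite -[X in _ --> X]e.
  by apply: cvgD; [exact: cvgZ|exact: cvg_cst].
apply: cvg_trans fx; apply: near_eq_cvg.
rewrite /E near_withinE; near=> h => _.
rewrite scalerA divff ?scale1r ?subrK //.
rewrite (_ : 0 = 0%:C) // (inj_eq (@complexI _)).
by near: h; exact: nbhs_dnbhs_neq.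
Unshelve. all: by end_near. Qed.

Lemma is_derive_in_cst A k x : is_derive_in A (fun=> k) x 0.
Proof.
rewrite /is_derive_in; under eq_fun do rewrite subrr scaler0.
exact: cvg_cst.
Qed.

Lemma is_derive_inB A f g x k l :
  is_derive_in A f x k -> is_derive_in A g x l ->
  is_derive_in A (fun y => f y - g y) x (k - l).
Proof.
move=> fk gl; rewrite /is_derive_in.
under eq_fun => h.
  have -> : (h%:C)^-1 *: (f (x + h) - g (x + h) - (f x - g x)) =
      (h%:C)^-1 *: (f (x + h) - f x) - (h%:C)^-1 *: (g (x + h) - g x).
    by rewrite -scalerBr !opprD !opprK [in LHS]addrACA.
  over.
by apply: cvgD; [exact: fk|apply: cvgN; exact: gl].
Qed.

Lemma is_derive_inM A f g x k l :
  is_derive_in A f x k -> is_derive_in A g x l ->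
  is_derive_in A (fun y => f y *m g y) x (k *m g x + f x *m l).
Proof.
move=> fk gl; rewrite /is_derive_in.
under eq_fun => h.
  have -> : (h%:C)^-1 *: (f (x + h) *m g (x + h) - f x *m g x) =
      ((h%:C)^-1 *: (f (x + h) - f x)) *m g (x + h) +
      f x *m ((h%:C)^-1 *: (g (x + h) - g x)).
    rewrite -scalemxAl -scalemxAr -scalerDr; congr (_ *: _).
    by rewrite mulmxBl mulmxBr addrA subrK.
  over.
apply: cvgD; apply: cvg_mulmx.
- exact: fk.
- exact: is_derive_in_cvg gl.
- exact: cvg_cst.
- exact: gl.
Qed.

Lemma is_derive_inZ A f x k (c : R[i]) :
  is_derive_in A f x k -> is_derive_in A (fun y => c *: f y) x (c *: k).
Proof.
move=> fk; have := is_derive_inM (is_derive_in_cst A c%:M x) fk.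
rewrite mul0mx add0r mul_scalar_mx.
by under eq_fun do rewrite mul_scalar_mx.
Qed.

End relative_derivative.

(** First-order expansion instead of a limit of quotients: the point y = x and
    the vanishing increment need no special treatment, and the error estimates
    below have exactly this shape. *)
Lemma is_derive_inP (R : realType) (m : nat) (A : set R)
    (f : R -> 'M[R[i]]_m) x l :
  is_derive_in A f x l <->
  forall e : R, 0 < e -> \forall y \near x, A y ->
    `|f y - f x - (y - x)%:C *: l| <= (e * `|y - x|)%:C.
Proof.
have xhE h : x + h - x = h by rewrite addrC addKr.
have scaled (h : R) : h != 0 -> forall e : R,
    (`|l - h%:C^-1 *: (f (x + h) - f x)| <= e%:C) =
    (`|f (x + h) - f x - h%:C *: l| <= (e * `|h|)%:C).
  move=> h0 e; have hC0 : h%:C != 0 :> R[i].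
    by apply: contra_neq h0 => /complexI.
  have -> : f (x + h) - f x - h%:C *: l =
      - (h%:C *: (l - h%:C^-1 *: (f (x + h) - f x))).
    by rewrite scalerBr scalerA divff // scale1r opprB.
  rewrite normrN normrZ normc_real mulrC rmorphM /= ler_pM2r //.
  by rewrite ltcR normr_gt0.
split=> [fl e e0|fl].
  have eC0 : 0 < e%:C by rewrite ltcR.
  move/cvgrPdist_le: fl => /(_ _ eC0).
  rewrite /dnbhs !near_withinE => fl.
  apply/nbhs0P; apply: filterS fl => h fl Ah.
  have [->|h0] := eqVneq h 0.
    by rewrite addr0 !subrr scale0r subr0 !normr0 mulr0 ler0c lexx.
  by rewrite xhE -scaled; [exact: fl|exact: h0].
apply/cvgrPdist_le => eps eps0.
have [e ee] : exists e : R, eps = e%:C by apply/complex_realP; exact: gtr0_real.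
rewrite ee ltcR in eps0 *.
rewrite /dnbhs !near_withinE.
move: (fl e eps0) => /nbhs0P; apply: filterS => h fe h0 Ah.
by move: (fe Ah); rewrite xhE scaled; [exact: id|exact: h0].
Qed.

(** * Real coordinates and moduli *)

Section coordinates.
Context (R : realType).

(** A boolean index makes the real and the imaginary part a single family, over
    which sums range and lemmas need one proof only. *)
Definition coord (b : bool) (z : R[i]) : R :=
  if b then complex.Re z else complex.Im z.

Lemma coordB b (y z : R[i]) : coord b (y - z) = coord b y - coord b z.
Proof. by case: b y z => -[y1 y2] [z1 z2]. Qed.

Lemma coordZ b (r : R) (z : R[i]) : coord b (r%:C * z) = r * coord b z.
Proof. by case: b z => -[z1 z2] /=; rewrite mul0r ?subr0 ?addr0. Qed.

Lemma coord_le_norm b (z : R[i]) (e : R) : `|z| <= e%:C -> `|coord b z| <= e.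
Proof.
rewrite normc_def lecR; apply: le_trans.
by rewrite -sqrtr_sqr ler_wsqrtr //; case: b; rewrite /= ?lerDl ?lerDr sqr_ge0.
Qed.

Lemma norm_le_coord (z : R[i]) (e : R) :
  (forall b, `|coord b z| <= e) -> `|z| <= (2 * e)%:C.
Proof.
move=> ze; have /= z1 := ze true; have /= z2 := ze false.
have e0 : 0 <= e by apply: le_trans z1.
rewrite normc_def lecR -(ger0_norm (_ : 0 <= 2 * e)) ?mulr_ge0 // -sqrtr_sqr.
have sq (s : R) : `|s| <= e -> s ^+ 2 <= e ^+ 2.
  by move=> se; rewrite -[leLHS]real_normK ?num_real // lerXn2r ?nnegrE.
rewrite ler_wsqrtr //; have := sq _ z1; have := sq _ z2; have := sqr_ge0 e.
by rewrite exprMn; lra.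
Qed.

Lemma is_derive_in_coord (m : nat) (A : set R) (f : R -> 'M[R[i]]_m)
    x l b i j e :
  is_derive_in A f x l -> 0 < e -> \forall y \near x, A y ->
  `|coord b (f y i j) - coord b (f x i j) - (y - x) * coord b (l i j)|
    <= e * `|y - x|.
Proof.
move=> /is_derive_inP fl /fl; apply: filterS => y fy /fy {}fy.
rewrite -coordZ -!coordB; apply: coord_le_norm; apply: le_trans fy.
have := entry_le_mx_norm (f y - f x - (y - x)%:C *: l) i j.
by rewrite !mxE.
Qed.

(** At an interior point the restriction of the increments to A is vacuous near
    0, so the relative derivative is the ordinary two-sided one: this gives
    access to the theory of real functions. *)
Lemma is_derive_in_coord_interior (m : nat) (A : set R) (f : R -> 'M[R[i]]_m)
    x l b i j :
  nbhs x A -> is_derive_in A f x l ->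
  is_derive x 1 (fun y => coord b (f y i j)) (coord b (l i j)).
Proof.
move=> Ax fl; set u := fun y => _.
have h : h^-1 *: (u (h *: 1 + x) - u x) @[h --> (0 : R)^'] --> coord b (l i j).
  apply/cvgrPdist_le => e e0; rewrite /dnbhs near_withinE.
  have : \forall y \near x,
      `|u y - u x - (y - x) * coord b (l i j)| <= e * `|y - x|.
    near=> y; near: y.
    by apply: filterS2 Ax (is_derive_in_coord b i j fl e0) => y Ay; exact.
  move=> /nbhs0P; apply: filterS => h.
  have -> : x + h - x = h by rewrite addrC addKr.
  move=> hu h0; rewrite [h *: 1]mulr1 [h + x]addrC.
  rewrite -(ler_pM2r (_ : 0 < `|h|)) ?normr_gt0 // -normrM mulrBl distrC.
  by rewrite -[h^-1 *: _]/(h^-1 * _) mulrAC mulVf // mul1r [_ * h]mulrC.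
apply: DeriveDef; first exact: cvgP h.
exact: cvg_lim h.
Unshelve. all: by end_near. Qed.

Lemma continuous_coord b : continuous (coord b).
Proof.
move=> z; apply/(@cvgrPdist_le _ _ _ _ (nbhs_filter z)) => e e0.
have eC0 : 0 < e%:C by rewrite ltcR.
move/cvgrPdist_le: (@cvg_id _ (nbhs z)) => /(_ _ eC0).
apply: filterS => y zy; rewrite -coordB; exact: coord_le_norm.
Qed.

Lemma is_derive_in_continuous (m : nat) (A : set R) (f df : R -> 'M[R[i]]_m) :
  (forall x, A x -> is_derive_in A f x (df x)) -> {within A, continuous f}.
Proof.
move=> fdf; apply/subspace_continuousP => x Ax U Uf.
have fU : \forall h \near (0 : R), h != 0 -> A (x + h) -> U (f (x + h)).
  exact: is_derive_in_cvg (fdf x Ax) U Uf.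
suff: \forall y \near x, A y -> U (f y) by [].
apply/nbhs0P; move: fU; apply: filterS => h fU Ah.
have [->|h0] := eqVneq h 0; last exact: fU.
by rewrite addr0; exact: nbhs_singleton Uf.
Qed.

Lemma within_continuous_coord (m : nat) (A : set R) (f : R -> 'M[R[i]]_m)
    b i j :
  {within A, continuous f} ->
  {within A, continuous (fun y => coord b (f y i j))}.
Proof.
move=> /subspace_continuousP fA; apply/subspace_continuousP => x Ax.
apply: (@cvg_comp _ _ _ (fun y => f y i j) (coord b)); last first.
  exact: continuous_coord.
exact: cvg_entry (fA x Ax).
Qed.
End coordinates.

Section modulus.
Context (R : realType).

(** The norm on R[i] takes its values in R[i]; modc is the same modulus as a
    real number, which can enter real sums and real differential inequalities. *)
Definition modc (z : R[i]) : R := complex.Re `|z|.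

Lemma modcE z : `|z| = (modc z)%:C.
Proof. by rewrite /modc normc_def. Qed.

Lemma modc_ge0 z : 0 <= modc z.
Proof. by rewrite -lecR -modcE normr_ge0. Qed.

Lemma sqr_modc z : modc z ^+ 2 = \sum_b coord b z ^+ 2.
Proof.
rewrite big_bool /modc normc_def sqr_sqrtr //.
by rewrite addr_ge0 ?sqr_ge0.
Qed.

(** Cauchy-Schwarz in the real plane. *)
Lemma coord_dot_le y z : \sum_b coord b y * coord b z <= modc y * modc z.
Proof.
apply: le_trans (ler_norm _) _.
rewrite -[leRHS]ger0_norm ?mulr_ge0 ?modc_ge0 // -ler_sqr ?nnegrE //.
rewrite !real_normK ?num_real // exprMn !sqr_modc !big_bool.
set a := coord true y; set b := coord false y.
set c := coord true z; set d := coord false z.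
rewrite /= -subr_ge0 (_ : _ - _ = (a * d - b * c) ^+ 2) ?sqr_ge0 //; ring.
Qed.

Lemma modc_mulmx_le (m : nat) (A B : 'M[R[i]]_m) K i j : `|A| <= K%:C ->
  modc ((A *m B) i j) <= \sum_k K * modc (B k j).
Proof.
move=> AK; rewrite -lecR -modcE mxE rmorph_sum.
apply: le_trans (ler_norm_sum _ _ _) _; apply: ler_sum => k _.
rewrite normrM rmorphM /= -modcE.
rewrite ler_wpM2r ?normr_ge0 //.
exact: le_trans (entry_le_mx_norm _ _ _) AK.
Qed.

Lemma modcD_le y z : modc (y + z) <= modc y + modc z.
Proof. by rewrite -lecR rmorphD /= -!modcE ler_normD. Qed.
End modulus.

Lemma mx_norm_mul_le (R : realType) (m : nat) (A B : 'M[R[i]]_m) (p q : R) :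
  0 <= p -> 0 <= q ->
  `|A| <= p%:C -> `|B| <= q%:C -> `|A *m B| <= (m%:R * (p * q))%:C.
Proof.
move=> p0 q0 Ap Bq; apply: mx_norm_le_entries; first by rewrite !mulr_ge0.
move=> i j; rewrite modcE lecR; apply: le_trans (modc_mulmx_le _ _ _ Ap) _.
apply: (@le_trans _ _ (\sum_(k < m) p * q)); last first.
  by rewrite sumr_const card_ord -[leLHS]mulr_natl.
apply: ler_sum => k _; rewrite ler_wpM2l //.
rewrite -lecR -modcE; exact: le_trans (entry_le_mx_norm _ _ _) Bq.
Qed.

(** * Mean value and Gronwall inequalities *)

Lemma is_derive_bigsum (R : realType) (I : Type) (r : seq I)
    (h : I -> R -> R) (x : R) (dh : I -> R) :
  (forall i, is_derive x 1 (h i) (dh i)) ->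
  is_derive x 1 (fun y => \sum_(i <- r) h i y) (\sum_(i <- r) dh i).
Proof.
move=> hd; elim: r => [|k r IH].
  rewrite big_nil; under eq_fun do rewrite big_nil.
  exact: is_derive_cst.
rewrite big_cons; under eq_fun do rewrite big_cons.
exact: is_deriveD (hd k) IH.
Qed.

(** phi(s) exp(- c s) - d s is nonincreasing. *)
Lemma scalar_gronwall (R : realType) (X c d : R) (phi dphi : R -> R) :
  0 <= X -> 0 <= c -> 0 <= d ->
  {within `[0, X], continuous phi} ->
  (forall s, s \in `]0, X[ -> is_derive s 1 phi (dphi s)) ->
  (forall s, s \in `]0, X[ -> dphi s <= c * phi s + d) ->
  phi 0 = 0 -> phi X <= d * X * expR (c * X).
Proof.
move=> X0 c0 d0 phic phid phile phi0.
pose psi s := phi s * expR (- c * s) - d * s.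
have psid s : s \in `]0, X[ -> is_derive s 1 psi
    ((dphi s - c * phi s) * expR (- c * s) - d).
  move=> sX; have phis := phid s sX.
  have lin (k : R) : is_derive s 1 (fun s => k * s) k.
    have := is_deriveZ k (is_derive_id s (1 : R)).
    by rewrite [_ *: _]mulr1.
  have De : is_derive s 1 (fun s => expR (- c * s)) (expR (- c * s) * - c).
    exact: is_derive1_comp (is_derive_expR (- c * s)) (lin (- c)).
  apply: (is_derive_eq (is_deriveB (is_deriveM phis De) (lin d))).
  by rewrite -[phi s *: _]/(phi s * _) -[_ *: dphi s]/(_ * dphi s); ring.
have psic : {within `[0, X], continuous psi}.
  apply/subspace_continuousP => s sX.
  have lin (k : R) : k * y @[y --> s] --> k * s.
    by apply: cvgM; [exact: cvg_cst|exact: cvg_id].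
  apply: cvgB; last by apply: cvg_within_filter; exact: lin.
  apply: cvgM; first by move/subspace_continuousP: phic; exact.
  apply: cvg_within_filter.
  by apply: (@cvg_comp _ _ _ (fun y => - c * y) expR _ _ _ (lin (- c)));
    exact: continuous_expR.
have psile : psi X <= psi 0.
  apply: (@ler0_derive1_le_cc _ psi 0 X _ _ psic); rewrite ?in_itv /= ?lexx ?X0 //.
    by move=> s /psid [].
  move=> s sX; have [_] := psid s sX; rewrite derive1E => ->.
  have sX' := sX; rewrite in_itv /= in sX'; case/andP: sX' => s0 _.
  have E1 : expR (- c * s) <= 1.
    by rewrite -expR0 ler_expR mulNr oppr_le0 mulr_ge0 // ltW.
  have E0 := expR_ge0 (- c * s).
  have := phile s sX; set E := expR _ in E1 E0 *.
  by nra.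
move: psile; rewrite /psi phi0 mul0r mulr0 subr0 subr_le0 mulNr expRN => H.
by rewrite -ler_pdivrMr ?expR_gt0.
Qed.

(** The mean value theorem holds in each real coordinate, with intermediate
    points that depend on the coordinate; the factor 2 is the price of
    recombining real and imaginary parts. *)
Lemma mean_value (R : realType) (m : nat) (p q M : R)
    (f df : R -> 'M[R[i]]_m) l :
  p <= q ->
  (forall x, x \in `[p, q] -> is_derive_in `[p, q] f x (df x)) ->
  (forall x, x \in `[p, q] -> `|df x - l| <= M%:C) ->
  `|f q - f p - (q - p)%:C *: l| <= (2 * (M * (q - p)))%:C.
Proof.
move=> pq fdf dfM.
have pp : p \in `[p, q] by rewrite in_itv /= lexx.
have M0 : 0 <= M by rewrite -ler0c; exact: le_trans (dfM p pp).
have qp0 : 0 <= q - p by rewrite subr_ge0.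
apply: mx_norm_le_entries; first by rewrite !mulr_ge0.
move=> i j; apply: norm_le_coord => b; rewrite !mxE.
rewrite !coordB coordZ.
have fc : {within `[p, q], continuous (fun y => coord b (f y i j))}.
  by apply: within_continuous_coord; exact: is_derive_in_continuous fdf.
have fd x : x \in `]p, q[ ->
    is_derive x 1 (fun y => coord b (f y i j)) (coord b (df x i j)).
  move=> xpq; apply: is_derive_in_coord_interior (fdf _ _); last first.
    exact: subset_itv_oo_cc.
  apply: filterS (near_in_itvoo xpq) => y; exact: subset_itv_oo_cc.
have [c cpq ->] := MVT_segment pq fd fc.
rewrite [_ * (q - p)]mulrC -mulrBr normrM (ger0_norm qp0) mulrC.
rewrite ler_wpM2r // -coordB.
apply: coord_le_norm; apply: le_trans (dfM c cpq).
by have := entry_le_mx_norm (df c - l) i j; rewrite !mxE.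
Qed.

(** With g the moduli of the entries of a solution of f' = A f + B, where A is
    bounded by K and B by e, the left-hand side bounds the derivative of the sum
    of the squares of the entries of f.  Every mixed product is split by
    2 a b <= a^2 + b^2, so that the sum of squares obeys a scalar linear
    differential inequality. *)
Lemma square_sum_growth (R : realType) (m : nat) (g : 'I_m -> 'I_m -> R)
    (K e : R) :
  0 <= K ->
  \sum_i \sum_j 2 * (g i j * (\sum_k K * g k j + e)) <=
  (2 * K * m%:R + 1) * (\sum_i \sum_j g i j ^+ 2) + m%:R ^+ 2 * e ^+ 2.
Proof.
move=> K0; set S := \sum_i \sum_j g i j ^+ 2.
have E1 : \sum_i \sum_j \sum_(k < m) K * g i j ^+ 2 = K * m%:R * S.
  rewrite mulr_sumr; apply: eq_bigr => i _; rewrite mulr_sumr.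
  by apply: eq_bigr => j _; rewrite sumr_const card_ord -[LHS]mulr_natr mulrAC.
have E2 : \sum_(i < m) \sum_j \sum_k K * g k j ^+ 2 = K * m%:R * S.
  rewrite sumr_const card_ord exchange_big /= -[LHS]mulr_natr [RHS]mulrAC.
  congr (_ * _); rewrite /S mulr_sumr.
  by apply: eq_bigr => i _; rewrite mulr_sumr.
have E3 : \sum_(i < m) \sum_(j < m) e ^+ 2 = m%:R ^+ 2 * e ^+ 2.
  by rewrite !sumr_const !card_ord -mulrnA -[LHS]mulr_natl natrM expr2.
apply: (@le_trans _ _ (\sum_i \sum_j ((\sum_(k < m) K * g i j ^+ 2) +
    (\sum_k K * g k j ^+ 2) + g i j ^+ 2 + e ^+ 2))); last first.
  under eq_bigr do rewrite !big_split /=.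
  by rewrite !big_split /= E1 E2 E3 -/S; lra.
apply: ler_sum => i _; apply: ler_sum => j _.
rewrite -big_split /= mulrDr mulrDr -addrA; apply: lerD; last first.
  by have := sqr_ge0 (g i j - e); rewrite sqrrB mulr2n; lra.
rewrite !mulr_sumr; apply: ler_sum => k _.
have := mulr_ge0 K0 (sqr_ge0 (g i j - g k j)).
by rewrite sqrrB mulr2n; lra.
Qed.

(** The scalar inequality is applied to the sum of the squares of all real
    coordinates, which, unlike a norm, is differentiable.  The constant C depends
    on m, X and K only: this uniformity over A, B and e is what turns a forcing
    term that is o(h) into a solution that is o(h). *)
Lemma matrix_gronwall (R : realType) (m : nat) (X K : R) : 0 <= X -> 0 <= K ->
  exists2 C : R, 0 <= C & forall (f A B : R -> 'M[R[i]]_m) (e : R), 0 <= e ->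
    (forall s, s \in `[0, X] -> is_derive_in `[0, X] f s (A s *m f s + B s)) ->
    f 0 = 0 ->
    (forall s, s \in `[0, X] -> `|A s| <= K%:C) ->
    (forall s, s \in `[0, X] -> `|B s| <= e%:C) ->
    `|f X| <= (C * e)%:C.
Proof.
move=> X0 K0.
pose c : R := 2 * K * m%:R + 1.
pose D : R := m%:R ^+ 2 * X * expR (c * X).
have c0 : 0 <= c by rewrite addr_ge0 // !mulr_ge0.
have D0 : 0 <= D by rewrite !mulr_ge0 ?exprn_ge0 ?expR_ge0.
(* The sum of squares is at most D * e ^+ 2, and D <= (1 + D) ^+ 2 avoids a
   square root. *)
exists (1 + D); first by rewrite addr_ge0.
move=> f A B e e0 fd f0 AK Be.
pose u i j b s := coord b (f s i j).
pose phi s := \sum_i \sum_j \sum_b u i j b s * u i j b s.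
have phiE s : phi s = \sum_i \sum_j modc (f s i j) ^+ 2.
  by apply: eq_bigr => i _; apply: eq_bigr => j _; rewrite sqr_modc.
pose df s := A s *m f s + B s.
pose dphi s := \sum_i \sum_j \sum_b
  (u i j b s *: coord b (df s i j) + u i j b s *: coord b (df s i j)).
have phi_le : phi X <= (m%:R ^+ 2 * e ^+ 2) * X * expR (c * X).
  apply: (@scalar_gronwall R X c _ phi dphi) => //.
  - by rewrite mulr_ge0 ?exprn_ge0.
  - apply/subspace_continuousP => s sX.
    apply: cvg_big => [|i _]; first exact: add_continuous.
    apply: cvg_big => [|j _]; first exact: add_continuous.
    apply: cvg_big => [|b _]; first exact: add_continuous.
    have : {within `[0, X], continuous (u i j b)}.
      by apply: within_continuous_coord; exact: is_derive_in_continuous fd.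
    by move=> /subspace_continuousP /(_ s sX) us; apply: cvgM.
  - move=> s sX.
    do 3 apply: is_derive_bigsum => ?.
    have us i j b : is_derive s 1 (u i j b) (coord b (df s i j)).
      apply: is_derive_in_coord_interior (fd _ _); last exact: subset_itv_oo_cc.
      apply: filterS (near_in_itvoo sX) => y; exact: subset_itv_oo_cc.
    exact: is_deriveM.
  - move=> s sX; have sX' := subset_itv_oo_cc sX.
    rewrite phiE.
    apply: le_trans (square_sum_growth (fun i j => modc (f s i j)) e K0).
    apply: ler_sum => i _; apply: ler_sum => j _.
    rewrite big_split /= -mulr2n -[leLHS]mulr_natl ler_pM2l ?ltr0n //.
    apply: le_trans (coord_dot_le _ _) _.
    rewrite ler_wpM2l ?modc_ge0 // /df mxE; apply: le_trans (modcD_le _ _) _.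
    apply: lerD; first exact: modc_mulmx_le (AK s sX').
    rewrite -lecR -modcE; apply: le_trans (Be s sX').
    exact: entry_le_mx_norm.
  - rewrite /phi big1 // => i _; rewrite big1 // => j _; rewrite big1 // => b _.
    by rewrite /u f0 mxE; case: b; rewrite mul0r.
apply: mx_norm_le_entries; first by rewrite mulr_ge0 // addr_ge0.
move=> i j; rewrite modcE lecR.
have Ce0 : 0 <= (1 + D) * e by rewrite mulr_ge0 // addr_ge0.
rewrite -ler_sqr ?nnegrE ?modc_ge0 //.
have : modc (f X i j) ^+ 2 <= phi X.
  rewrite phiE (bigD1 i) //= (bigD1 j) //= -addrA lerDl.
  rewrite addr_ge0 //; first by apply: sumr_ge0 => k _; exact: sqr_ge0.
  by apply: sumr_ge0 => k _; apply: sumr_ge0 => k' _; exact: sqr_ge0.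
move=> /le_trans -> //; apply: le_trans phi_le _.
have -> : m%:R ^+ 2 * e ^+ 2 * X * expR (c * X) = D * e ^+ 2.
  by rewrite /D; ring.
rewrite exprMn ler_wpM2r ?sqr_ge0 // expr2; nra.
Qed.

(** * Uniformity on compact segments *)

Lemma norm_mx_real (R : realType) (m : nat) (A : 'M[R[i]]_m) :
  exists c : R, `|A| = c%:C.
Proof. by apply/complex_realP; exact: normr_real. Qed.

Lemma segment_bounded (R : realType) (m : nat) (p q : R) (f : R -> 'M[R[i]]_m) :
  {within `[p, q], continuous f} ->
  exists2 K : R, 0 <= K & forall s, s \in `[p, q] -> `|f s| <= K%:C.
Proof.
move=> /subspace_continuousP fc.
have /compact_near_coveringP/near_covering_withinP cov := @segment_compact R p q.
have [] := cov _ (pinfty_nbhs R) (fun K s => `|f s| <= K%:C) _.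
  move=> s spq; have e0 : 0 < 1%:C :> R[i] by rewrite ltcR.
  move: (fc s spq) => /cvgrPdist_le /(_ _ e0); rewrite near_withinE => fs.
  have [c cE] := norm_mx_real (f s).
  exists ([set y : R | `[p, q]%classic y -> `|f s - f y| <= 1%:C],
          [set K : R | c + 1 <= K]).
    by split=> //=; exact: nbhs_pinfty_ge (num_real _).
  move=> [y K] /= [fy cK] ypq.
  have -> : f y = f s - (f s - f y) by rewrite opprB addrC subrK.
  apply: le_trans (ler_normB _ _) _; rewrite cE.
  apply: (@le_trans _ _ (c + 1)%:C); last by rewrite lecR.
  by rewrite rmorphD /=; apply: lerD; [exact: lexx|exact: fy].
move=> M [_ MK]; exists (Num.max 0 (M + 1)); first by rewrite le_max lexx.
move=> s spq; apply: (@le_trans _ _ (M + 1)%:C).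
  by apply: MK => //; rewrite ltrDl.
by rewrite lecR le_max lexx orbT.
Qed.

Lemma semistripE (R : realType) (a x t : R) :
  semistrip a (x, t) <-> 0 <= x /\ 0 <= t < a.
Proof. by rewrite /semistrip /= !in_itv /= andbT. Qed.

(** Continuity at each point (x, t) gives a product neighbourhood; compactness
    of [0, X] extracts from them one neighbourhood of t that serves all x. *)
Lemma semistrip_unif_continuous (R : realType) (m : nat) (a X t e : R)
    (H : R -> R -> 'M[R[i]]_m) :
  {within semistrip a, continuous (fun p : R * R => H p.1 p.2)} ->
  0 <= t < a -> 0 < e ->
  \forall s \near t, 0 <= s < a ->
    forall x, x \in `[0, X] -> `|H x s - H x t| <= e%:C.
Proof.
move=> /subspace_continuousP Hc ta e0.
have /compact_near_coveringP/near_covering_withinP cov := @segment_compact R 0 X.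
have := cov _ (nbhs t) (fun s x => 0 <= s < a -> `|H x s - H x t| <= e%:C) _.
move=> tube; suff : \forall s \near t, `[0, X] `<=`
    (fun x => 0 <= s < a -> `|H x s - H x t| <= e%:C).
  by apply: filterS => s h sa x xX; exact: h.
apply: tube => x xX.
have x0 : 0 <= x by move: xX; rewrite /= in_itv /= => /andP[].
have e20 : 0 < (e / 2)%:C by rewrite ltcR divr_gt0.
have /Hc : semistrip a (x, t) by apply/semistripE.
move=> /cvgrPdist_le /(_ _ e20); rewrite near_withinE => -[[A B] /= [xA tB] AB].
exists (A, B) => // -[y s] /= [Ay Bs] yX sa.
have y0 : 0 <= y by move: yX; rewrite in_itv /= => /andP[].
have Bt : B t := nbhs_singleton tB.
have h1 : `|H x t - H y s| <= (e / 2)%:C.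
  by apply: (AB (y, s)) => //; apply/semistripE.
have h2 : `|H x t - H y t| <= (e / 2)%:C.
  by apply: (AB (y, t)) => //; apply/semistripE.
have -> : H y s - H y t = (H x t - H y t) - (H x t - H y s).
  by rewrite opprB addrACA [- H y t + _]addrC addrACA subrr add0r.
apply: le_trans (ler_normB _ _) _.
have -> : e%:C = (e / 2)%:C + (e / 2)%:C :> R[i] by rewrite -rmorphD /= -splitr.
exact: lerD.
Qed.

Lemma within_continuous_curve (R : realType) (m : nat) (S : set (R * R))
    (A : set R) (f : R * R -> 'M[R[i]]_m) (g : R -> R * R) :
  {within S, continuous f} -> continuous g -> (forall s, A s -> S (g s)) ->
  {within A, continuous (fun s => f (g s))}.
Proof.
move=> /subspace_continuousP fc gc AS; apply/subspace_continuousP => s As U Uf.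
have fU : \forall p \near g s, S p -> U (f p) by exact: fc (g s) (AS s As) U Uf.
suff: \forall y \near s, A y -> U (f (g y)) by [].
have : \forall y \near s, S (g y) -> U (f (g y)) by exact: gc s _ fU.
by apply: filterS => y h Ay; exact: h (AS y Ay).
Qed.

(** The mean value inequality reduces uniform differentiability in s to the
    uniform continuity of the partial derivative. *)
Lemma semistrip_unif_differentiable (R : realType) (m : nat) (a X t e : R)
    (H Ht : R -> R -> 'M[R[i]]_m) :
  (forall x s, semistrip a (x, s) ->
     is_derive_in `[0, a[ (fun s => H x s) s (Ht x s)) ->
  {within semistrip a, continuous (fun p : R * R => Ht p.1 p.2)} ->
  0 <= t < a -> 0 < e ->
  \forall s \near t, 0 <= s < a -> forall x, x \in `[0, X] ->
    `|H x s - H x t - (s - t)%:C *: Ht x t| <= (2 * (e * `|s - t|))%:C.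
Proof.
move=> H_t Htc ta e0.
have /nbhs_ballP[d d0 tube] := semistrip_unif_continuous X Htc ta e0.
apply/nbhs_ballP; exists d => // s sd sa x xX.
have x0 : 0 <= x by move: xX; rewrite in_itv /= => /andP[].
case/andP: ta => t0 ta; case/andP: sa => s0 sa.
have sub p q y : 0 <= p -> q < a -> ball t d p -> ball t d q -> y \in `[p, q] ->
    is_derive_in `[p, q] (fun s => H x s) y (Ht x y) /\
    `|Ht x y - Ht x t| <= e%:C.
  rewrite /ball /= in_itv /= => p0 qa pd qd /andP[py yq].
  have ya : 0 <= y < a by rewrite (le_trans p0) // (le_lt_trans yq).
  split.
    apply: (is_derive_in_subset (B := `[0, a[)); last first.
      by apply: H_t; apply/semistripE.
    by apply/subset_itv; rewrite bnd_simp.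
  apply: tube => //; rewrite /ball /=.
  move: pd qd; rewrite !ltr_distl => /andP[? ?] /andP[? ?].
  by apply/andP; split; lra.
have td : ball t d t by exact: ballxx.
(* The mean value inequality is stated on an ordered segment, and s may lie on
   either side of t. *)
have [ts|st] := leP t s.
  rewrite ger0_norm ?subr_ge0 //; apply: (mean_value (df := Ht x)) => // y ysp.
    by have [] := sub t s y t0 sa td sd ysp.
  by have [] := sub t s y t0 sa td sd ysp.
rewrite [`|s - t|]distrC ger0_norm ?subr_ge0 ?(ltW st) //.
have -> : H x s - H x t - (s - t)%:C *: Ht x t =
    - (H x t - H x s - (t - s)%:C *: Ht x t).
  by rewrite -[s - t]opprB rmorphN /= scaleNr !opprD !opprK [- H x t + _]addrC.
rewrite normrN; apply: (mean_value (df := Ht x)); first exact: ltW.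
  by move=> y ysp; have [] := sub s t y s0 ta sd td ysp.
by move=> y ysp; have [] := sub s t y s0 ta sd td ysp.
Qed.

(** * Differentiating the fundamental solution in the parameter *)

(** The defect W1 - W0 - h V of the first-order expansion satisfies the equation
    with coefficient G1 and a forcing term that contains only the increments
    of G. *)
Lemma increment_split (R : realType) (m : nat)
    (G1 G0 Gt W1 W0 V : 'M[R[i]]_m) (h : R[i]) :
  G1 *m W1 - G0 *m W0 - h *: (G0 *m V + Gt *m W0) =
  G1 *m (W1 - W0 - h *: V) +
  ((G1 - G0 - h *: Gt) *m W0 + h *: ((G1 - G0) *m V)).
Proof.
rewrite !mulmxBr !mulmxBl -scalemxAr -scalemxAl.
move: (G1 *m W1) (G1 *m W0) (G0 *m W0) (G1 *m V) (G0 *m V) (Gt *m W0).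
move=> A B C D E K.
by apply/matrixP => i j; rewrite !mxE; ring.
Qed.

(** Writing F_x = G_t + G F - F G cancels the term F G W that the product rule
    produces, and what remains besides G_t W has G as a common left factor. *)
Lemma zero_curvature_derivative (R : realType) (m : nat) (A : set R)
    (G F W : R -> 'M[R[i]]_m) (Gt Fx : 'M[R[i]]_m) (F0 : 'M[R[i]]_m) x :
  Gt - Fx + (G x *m F x - F x *m G x) = 0 ->
  is_derive_in A F x Fx -> is_derive_in A W x (G x *m W x) ->
  is_derive_in A (fun y => F y *m W y - W y *m F0) x
    (G x *m (F x *m W x - W x *m F0) + Gt *m W x).
Proof.
move=> zc dF dW.
have dWF0 := is_derive_inM dW (is_derive_in_cst A F0 x).
have := is_derive_inB (is_derive_inM dF dW) dWF0.
congr (is_derive_in _ _ _ _).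
have -> : Fx = Gt + (G x *m F x - F x *m G x).
  by apply/eqP; rewrite eq_sym -subr_eq0 addrAC zc.
rewrite mulmx0 addr0 mulmxBr !mulmxDl mulNmx !mulmxA.
move: (_ *m _) (_ *m _) (_ *m _) (_ *m _) => a b c d.
by apply/matrixP => i j; rewrite !mxE; ring.
Qed.

(** Since F W - W F(0, t) solves the equation that W_t should solve, Gronwall's
    inequality applied to the defect of the first-order expansion in t shows that
    it is W_t. *)
Lemma fundamental_solution_derive_t (R : realType) (m : nat) (a : R)
    (G F Gt Fx W : R -> R -> 'M[R[i]]_m)
    (G_t : forall x t, semistrip a (x, t) ->
       is_derive_in `[0, a[ (fun s => G x s) t (Gt x t))
    (F_x : forall x t, semistrip a (x, t) ->
       is_derive_in `[0, +oo[ (fun y => F y t) x (Fx x t))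
    (G_cont : {within semistrip a, continuous (fun p : R * R => G p.1 p.2)})
    (Gt_cont : {within semistrip a, continuous (fun p : R * R => Gt p.1 p.2)})
    (zero_curvature : forall x t, semistrip a (x, t) ->
       Gt x t - Fx x t + (G x t *m F x t - F x t *m G x t) = 0)
    (W_sol : forall t : R, 0 <= t < a ->
       normalized_solution `[0, +oo[ (fun x => G x t) (fun x => W x t)) x t :
  semistrip a (x, t) ->
  is_derive_in `[0, a[ (fun s => W x s) t (F x t *m W x t - W x t *m F 0 t).
Proof.
move=> /semistripE[x0 ta].
have itv0x y : `[0, x]%classic y -> 0 <= y by rewrite /= in_itv /= => /andP[].
have sub0x : `[0, x]%classic `<=` `[0, +oo[%classic.
  by move=> y /itv0x y0; rewrite /= in_itv /= y0.
pose V y := F y t *m W y t - W y t *m F 0 t.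
have W_x s y : 0 <= s < a -> y \in `[0, x] ->
    is_derive_in `[0, x] (fun y => W y s) y (G y s *m W y s).
  move=> sa yx; apply: (is_derive_in_subset sub0x).
  by apply: (W_sol s sa).1; exact: sub0x.
have V_x y : y \in `[0, x] ->
    is_derive_in `[0, x] V y (G y t *m V y + Gt y t *m W y t).
  move=> yx; have yt : semistrip a (y, t).
    by apply/semistripE; rewrite (itv0x y).
  apply: (zero_curvature_derivative (F := F^~ t) (G := G^~ t) (W := W^~ t)
    (zero_curvature _ _ yt)); last exact: W_x.
  exact: is_derive_in_subset sub0x (F_x _ _ yt).
have [KG KG0 G_bnd] : exists2 K : R, 0 <= K &
    forall y, y \in `[0, x] -> `|G y t| <= K%:C.
  apply: segment_bounded.
  apply: (within_continuous_curve (g := fun y => (y, t)) G_cont) => y.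
    apply: (@cvg_pair _ _ _ (nbhs y) (nbhs y) (nbhs t)); first exact: cvg_id.
    exact: cvg_cst.
  by move=> /itv0x y0; apply/semistripE.
have [KW KW0 W_bnd] :=
  segment_bounded (is_derive_in_continuous (fun y => W_x t y ta)).
have [KV KV0 V_bnd] := segment_bounded (is_derive_in_continuous V_x).
have [C C0 gronwall] := matrix_gronwall m x0 (addr_ge0 KG0 ler01).
apply/is_derive_inP => e e0.
pose M := C * (m%:R * (2 * KW + KV)).
have M0 : 0 <= M by rewrite !mulr_ge0 // addr_ge0 // mulr_ge0.
(* The bound 1 keeps G(., s) below KG + 1, the constant for which C was
   obtained; the bound e / (M + 1) makes the resulting error M * eta at most e. *)
pose eta := Num.min 1 (e / (M + 1)).
have M1 : 0 < M + 1 by rewrite ltr_wpDl.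
have eta0 : 0 < eta by rewrite lt_min ltr01 divr_gt0.
have Meta : M * eta <= e.
  apply: (@le_trans _ _ (M * (e / (M + 1)))).
    by rewrite ler_wpM2l // ge_min lexx orbT.
  by rewrite mulrCA ler_piMr ?(ltW e0) // ler_pdivrMr // mul1r lerDl.
have tubeG := semistrip_unif_continuous x G_cont ta eta0.
have tubeGt := semistrip_unif_differentiable x G_t Gt_cont ta eta0.
apply: filterS2 tubeG tubeGt => s tG tGt; rewrite /= in_itv /= => sa.
have {}tG := tG sa; have {}tGt := tGt sa.
set h := s - t.
pose D y := W y s - W y t - h%:C *: V y.
pose B y := (G y s - G y t - h%:C *: Gt y t) *m W y t +
  h%:C *: ((G y s - G y t) *m V y).
have xx : x \in `[0, x] by rewrite in_itv /= x0 lexx.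
have D_x y : y \in `[0, x] -> is_derive_in `[0, x] D y (G y s *m D y + B y).
  move=> yx.
  have -> : G y s *m D y + B y = G y s *m W y s - G y t *m W y t -
      h%:C *: (G y t *m V y + Gt y t *m W y t) by rewrite increment_split.
  apply: is_derive_inB; last by apply: is_derive_inZ; exact: V_x.
  by apply: is_derive_inB; exact: W_x.
have D0 : D 0 = 0.
  rewrite /D /V (W_sol s sa).2 (W_sol t ta).2 mulmx1 mul1mx.
  by rewrite !subrr scaler0 subr0.
pose b := m%:R * (2 * KW + KV) * (eta * `|h|).
have b0 : 0 <= b by rewrite !mulr_ge0 ?addr_ge0 ?mulr_ge0 // ltW.
have G_bnd_s y : y \in `[0, x] -> `|G y s| <= (KG + 1)%:C.
  move=> yx; rewrite -[G y s](subrK (G y t)) addrC.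
  apply: le_trans (ler_normD _ _) _; rewrite rmorphD /=.
  apply: lerD; first exact: G_bnd.
  by apply: le_trans (tG y yx) _; rewrite lecR ge_min lexx.
have B_bnd y : y \in `[0, x] -> `|B y| <= b%:C.
  move=> yx; apply: le_trans (ler_normD _ _) _.
  have -> : b = m%:R * (2 * (eta * `|h|) * KW) + `|h| * (m%:R * (eta * KV)).
    by rewrite /b; ring.
  rewrite [leRHS]rmorphD; apply: lerD.
    by apply: mx_norm_mul_le => //; rewrite ?mulr_ge0 ?(ltW eta0) //;
      [exact: tGt|exact: W_bnd].
  rewrite normrZ normc_real [leRHS]rmorphM.
  apply: ler_wpM2l; first by rewrite lecR.
  by apply: mx_norm_mul_le => //; rewrite ?(ltW eta0) //;
    [exact: tG|exact: V_bnd].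
have := gronwall D _ B b b0 D_x D0 G_bnd_s B_bnd.
move=> /le_trans; apply; rewrite lecR.
have -> : C * b = M * eta * `|h| by rewrite /b /M; ring.
by rewrite ler_wpM2r.
Qed.

(** * Compatibility of the two fundamental solutions *)

(* Gt and Fx are the partial derivatives of G in t and of F in x; Rf is the
   normalized fundamental solution R(x,t). *)
Theorem theorem1p1 (R : realType) (m : nat) (a : R) (a_gt0 : 0 < a)
    (G F Gt Fx W Rf : R -> R -> 'M[R[i]]_m)
    (G_t : forall x t, semistrip a (x, t) ->
       is_derive_in `[0, a[ (fun s => G x s) t (Gt x t))
    (F_x : forall x t, semistrip a (x, t) ->
       is_derive_in `[0, +oo[ (fun y => F y t) x (Fx x t))
    (G_cont : {within semistrip a, continuous (fun p : R * R => G p.1 p.2)})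
    (Gt_cont : {within semistrip a, continuous (fun p : R * R => Gt p.1 p.2)})
    (F_cont : {within semistrip a, continuous (fun p : R * R => F p.1 p.2)})
    (zero_curvature : forall x t, semistrip a (x, t) ->
       Gt x t - Fx x t + (G x t *m F x t - F x t *m G x t) = 0)
    (W_sol : forall t : R, 0 <= t < a ->
       normalized_solution `[0, +oo[ (fun x => G x t) (fun x => W x t))
    (Rf_sol : forall x : R, 0 <= x ->
       normalized_solution `[0, a[ (fun t => F x t) (fun t => Rf x t)) :
  forall x t, semistrip a (x, t) ->
    W x t *m Rf 0 t = Rf x t *m W x 0.
Proof.
move=> x t /semistripE[x0 ta]; case/andP: (ta) => t0 t_a.
have sub0t : `[0, t]%classic `<=` `[0, a[%classic.
  by apply/subset_itv; rewrite bnd_simp.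
have strip y s : 0 <= y -> s \in `[0, t] -> semistrip a (y, s).
  by move=> y0 /sub0t; rewrite /= in_itv /= => sa; apply/semistripE.
pose P s := W x s *m Rf 0 s - Rf x s *m W x 0.
have R_t y s : 0 <= y -> s \in `[0, t] ->
    is_derive_in `[0, t] (Rf y) s (F y s *m Rf y s).
  move=> y0 st; apply: (is_derive_in_subset sub0t).
  by apply: (Rf_sol y y0).1; exact: sub0t.
have P_t s : s \in `[0, t] -> is_derive_in `[0, t] P s (F x s *m P s + 0).
  move=> st.
  have W_t : is_derive_in `[0, t] (W x) s (F x s *m W x s - W x s *m F 0 s).
    apply: (is_derive_in_subset sub0t).
    by apply: (fundamental_solution_derive_t G_t F_x); last exact: strip.
  have -> : F x s *m P s + 0 =
      (F x s *m W x s - W x s *m F 0 s) *m Rf 0 s + W x s *m (F 0 s *m Rf 0 s) -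
      (F x s *m Rf x s *m W x 0 + Rf x s *m 0).
    by rewrite addr0 mulmxBr mulmxBl mulmx0 addr0 !mulmxA subrK.
  apply: is_derive_inB; apply: is_derive_inM; last exact: is_derive_in_cst.
  - exact: W_t.
  - exact: R_t.
  - exact: R_t.
(* Both sides start from W x 0, and the equation for P is homogeneous, so
   Gronwall's inequality with a zero forcing term gives P t = 0. *)
have [K K0 F_bnd] : exists2 K : R, 0 <= K &
    forall s, s \in `[0, t] -> `|F x s| <= K%:C.
  apply: segment_bounded.
  apply: (within_continuous_curve (g := fun s => (x, s)) F_cont) => [y|s st].
    apply: (@cvg_pair _ _ _ (nbhs y) (nbhs x) (nbhs y)); first exact: cvg_cst.
    exact: cvg_id.
  exact: strip.
have [C _ gronwall] := matrix_gronwall m t0 K0.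
have P0 : P 0 = 0.
  rewrite /P (Rf_sol 0 (lexx 0)).2 (Rf_sol x x0).2 mulmx1 mul1mx.
  exact: subrr.
have := gronwall P (F x) (fun=> 0) 0 (lexx 0) P_t P0 F_bnd.
rewrite mulr0 => Pt; apply/eqP; rewrite -subr_eq0 -normr_le0.
by apply: Pt => s _; rewrite normr0.
Qed.
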